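(* Let $\mathbf{k}$ be an algebraically closed field of characteristic zero, $t$ an indeterminate and $n\geq 1$. Let $A_n$ be the $\mathbf{k}[t]$-algebra generated by $x_1,\ldots,x_{2n-1},x_{2n}$ subject to the relations, for $j>i$, $$x_jx_i=\begin{cases}x_ix_j+t,&\text{if } j=2\ell,\ i=2\ell-1 \text{ for some } \ell,\\ x_ix_j,&\text{otherwise.}\end{cases}$$ Then $t$ is a regular element in $A_n$ and the semiclassical limit $\overline{A_n}:=A_n/tA_n$ is Poisson isomorphic to the $n$-th Poisson Weyl algebra $B_n$. In particular, $A_n$ is an iterated skew polynomial $\mathbf{k}[t]$-algebra $$A_n=\mathbf{k}[t][x_1][x_2;\nu_2]\ldots[x_{2n-1}][x_{2n};\nu_{2n}],$$ where the $\mathbf{k}[t]$-linear map $\nu_{2j}$ is the derivation defined by $\nu_{2j}(x_i)=t$ if $i=2j-1$ and $\nu_{2j}(x_i)=0$ otherwise; namely $\nu_{2j}=t\frac{\partial}{\partial x_{2j-1}}$.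
   Context: All algebras are associative and unital. A regular element $\hbar$ of an algebra $A$ is a nonzero, nonunit, non-zero-divisor and central element such that $A/\hbar A$ is commutative. Then the semiclassical limit $A/\hbar A$ is a Poisson algebra with Poisson bracket $\{\overline{a},\overline{b}\}=\overline{\hbar^{-1}(ab-ba)}$. A Poisson algebra is a commutative $\mathbf{k}$-algebra $R$ with a bilinear product $\{-,-\}$ such that $(R,\{-,-\})$ is a Lie algebra and $\{ab,c\}=a\{b,c\}+\{a,c\}b$. Poisson isomorphic means isomorphic via an algebra isomorphism $f$ with $f(\{a,b\})=\{f(a),f(b)\}$. The $n$-th Poisson Weyl algebra $B_n$ is $\mathbf{k}[x_1,\ldots,x_{2n}]$ with the Poisson bracket $$\{f,g\}=\sum_{i=1}^n\left(-\frac{\partial f}{\partial x_{2i-1}}\frac{\partial g}{\partial x_{2i}}+\frac{\partial g}{\partial x_{2i-1}}\frac{\partial f}{\partial x_{2i}}\right).$$ For an algebra $R$ over a commutative ring $S$ and an $S$-linear derivation $\nu$ on $R$, $R[z;\nu]$ denotes the skew polynomial $S$-algebra, which is a free left $R$-module with basis $\{z^i\}_{i\ge0}$ and multiplication determined by $za=az+\nu(a)$ for $a\in R$; $R[z]$ is the case $\nu=0$. *)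

(* Defs.v *)
From HB Require Import structures.
From mathcomp Require Import all_boot all_algebra.
From mathcomp Require Import boolp.
From mathcomp Require monalg.
From mathcomp Require Import mpoly.
From mathcomp Require Import ring.

Set Implicit Arguments.
Unset Strict Implicit.
Unset Printing Implicit Defensive.

Import GRing.Theory.
Local Open Scope ring_scope.
Local Open Scope quotient_scope.

(* MathComp only provides quotients of commutative rings. Properness is needed
   because algType requires 1 != 0. *)

Record two_sided_ideal (A : nzRingType) (I : A -> Prop) : Prop := {
  ideal0 : I 0;
  idealD : forall x y, I x -> I y -> I (x + y);
  idealMl : forall a x, I x -> I (a * x);
  idealMr : forall a x, I x -> I (x * a)
}.

Record proper_ideal (A : nzRingType) := ProperIdeal {
  ideal_pred :> A -> Prop;
  ideal_two_sided : two_sided_ideal ideal_pred;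
  ideal_proper : ~ ideal_pred 1
}.

Section QuotientAlgebra.
Variables (S : nzRingType) (A : algType S) (I : proper_ideal A).

Definition ideal_mem : {pred A} := fun x => `[< I x >].

Lemma ideal_memP x : reflect (I x) (x \in ideal_mem).
Proof. exact: asboolP. Qed.

Lemma ideal_zmod_closed : zmod_closed ideal_mem.
Proof.
have [i0 iD iMl _] := ideal_two_sided I.
split; first exact/ideal_memP.
move=> x y /ideal_memP Ix /ideal_memP Iy; apply/ideal_memP.
by apply: iD => //; rewrite -mulN1r; apply: iMl.
Qed.

HB.instance Definition _ := GRing.isZmodClosed.Build A ideal_mem
  ideal_zmod_closed.

Definition quot_alg : Type := Quotient.quot ideal_mem.
HB.instance Definition _ := GRing.Zmodule.on quot_alg.
HB.instance Definition _ := EqQuotient.on quot_alg.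

Definition quot_pi (x : A) : quot_alg := \pi_(quot_alg) x.

Lemma quot_pi_eq x y : quot_pi x = quot_pi y <-> I (x - y).
Proof.
split=> [/eqP|Ixy].
  by rewrite /quot_pi -(Quotient.idealrBE ideal_mem) => /ideal_memP.
by apply/eqP; rewrite /quot_pi -(Quotient.idealrBE ideal_mem); apply/ideal_memP.
Qed.

Lemma quot_pi_repr (x : quot_alg) : quot_pi (repr x) = x.
Proof. exact: reprK. Qed.

Lemma quot_pi_surj (x : quot_alg) : exists a, x = quot_pi a.
Proof. by exists (repr x); rewrite quot_pi_repr. Qed.

Lemma quot_piD : {morph quot_pi : x y / x + y}.
Proof. exact: Quotient.pi_add. Qed.

Definition quot_one : quot_alg := quot_pi 1.
Definition quot_mul (x y : quot_alg) : quot_alg := quot_pi (repr x * repr y).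
Definition quot_scale (s : S) (x : quot_alg) : quot_alg := quot_pi (s *: repr x).

Lemma quot_reprB x : I (repr (quot_pi x) - x).
Proof. by apply/quot_pi_eq; rewrite quot_pi_repr. Qed.

Lemma quot_mulE x y : quot_mul (quot_pi x) (quot_pi y) = quot_pi (x * y).
Proof.
have [_ iD iMl iMr] := ideal_two_sided I.
apply/quot_pi_eq; set x' := repr _; set y' := repr _.
have -> : x' * y' - x * y = (x' - x) * y' + x * (y' - y).
  by rewrite mulrBl mulrBr addrA addrNK.
by apply: iD; [apply: iMr|apply: iMl]; apply: quot_reprB.
Qed.

Lemma quot_scaleE s x : quot_scale s (quot_pi x) = quot_pi (s *: x).
Proof.
have [_ _ iMl _] := ideal_two_sided I.
apply/quot_pi_eq; rewrite -scalerBr -[X in _ *: X]mul1r scalerAl.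
exact/iMl/quot_reprB.
Qed.

Fact quot_mulA : associative quot_mul.
Proof.
move=> x y z; rewrite -(quot_pi_repr x) -(quot_pi_repr y) -(quot_pi_repr z).
by rewrite !quot_mulE mulrA.
Qed.
Fact quot_mul1 : left_id quot_one quot_mul.
Proof. by move=> x; rewrite -(quot_pi_repr x) quot_mulE mul1r. Qed.
Fact quot_mulr1 : right_id quot_one quot_mul.
Proof. by move=> x; rewrite -(quot_pi_repr x) quot_mulE mulr1. Qed.
Fact quot_mulDl : left_distributive quot_mul +%R.
Proof.
move=> x y z; rewrite -(quot_pi_repr x) -(quot_pi_repr y) -(quot_pi_repr z).
by rewrite !(quot_mulE, =^~ quot_piD) mulrDl.
Qed.
Fact quot_mulDr : right_distributive quot_mul +%R.
Proof.
move=> x y z; rewrite -(quot_pi_repr x) -(quot_pi_repr y) -(quot_pi_repr z).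
by rewrite !(quot_mulE, =^~ quot_piD) mulrDr.
Qed.
Fact quot_one_neq0 : quot_one != 0.
Proof.
have E0 : quot_pi 0 = 0 by apply: (addIr (quot_pi 0)); rewrite -quot_piD !add0r.
apply/eqP; rewrite -E0 => /quot_pi_eq; rewrite subr0; exact: ideal_proper.
Qed.

HB.instance Definition _ := GRing.Zmodule_isNzRing.Build quot_alg
  quot_mulA quot_mul1 quot_mulr1 quot_mulDl quot_mulDr quot_one_neq0.

Fact quot_scaleA a b x : quot_scale a (quot_scale b x) = quot_scale (a * b) x.
Proof. by rewrite -(quot_pi_repr x) !quot_scaleE scalerA. Qed.
Fact quot_scale1 : left_id 1 quot_scale.
Proof. by move=> x; rewrite -(quot_pi_repr x) quot_scaleE scale1r. Qed.
Fact quot_scaleDr : right_distributive quot_scale +%R.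
Proof.
move=> s x y; rewrite -(quot_pi_repr x) -(quot_pi_repr y).
by rewrite !(quot_scaleE, =^~ quot_piD) scalerDr.
Qed.
Fact quot_scaleDl x : {morph quot_scale^~ x : a b / a + b}.
Proof.
by move=> a b; rewrite -(quot_pi_repr x) !(quot_scaleE, =^~ quot_piD) scalerDl.
Qed.

HB.instance Definition _ := GRing.Zmodule_isLmodule.Build S quot_alg
  quot_scaleA quot_scale1 quot_scaleDr quot_scaleDl.

Fact quot_scaleAl (a : S) (x y : quot_alg) : a *: (x * y) = a *: x * y.
Proof.
rewrite -(quot_pi_repr x) -(quot_pi_repr y).
by rewrite /GRing.scale /GRing.mul /= !(quot_scaleE, quot_mulE) scalerAl.
Qed.
HB.instance Definition _ := GRing.Lmodule_isLalgebra.Build S quot_alg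
  quot_scaleAl.

Fact quot_scaleAr (a : S) (x y : quot_alg) : a *: (x * y) = x * (a *: y).
Proof.
rewrite -(quot_pi_repr x) -(quot_pi_repr y).
by rewrite /GRing.scale /GRing.mul /= !(quot_scaleE, quot_mulE) scalerAr.
Qed.
HB.instance Definition _ := GRing.Lalgebra_isAlgebra.Build S quot_alg
  quot_scaleAr.

Fact quot_pi_zmod_morphism : zmod_morphism quot_pi.
Proof. by move=> x y; apply: (addIr (quot_pi y)); rewrite -quot_piD !subrK. Qed.
HB.instance Definition _ := GRing.isZmodMorphism.Build A quot_alg quot_pi
  quot_pi_zmod_morphism.
Fact quot_pi_monoid_morphism : monoid_morphism quot_pi.
Proof. by split=> // x y; rewrite -quot_mulE. Qed.
HB.instance Definition _ := GRing.isMonoidMorphism.Build A quot_alg quot_pi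
  quot_pi_monoid_morphism.
Fact quot_pi_scalable : scalable quot_pi.
Proof. by move=> a x; rewrite -quot_scaleE. Qed.
HB.instance Definition _ := GRing.isScalable.Build S A quot_alg *:%R quot_pi
  quot_pi_scalable.

End QuotientAlgebra.

(* Imported locally, as its notation for commutative polynomials clashes with
   that of mpoly. *)
Section FreeAlgebra.
Import monalg.
Variables (S : comNzRingType) (I : choiceType).

(* The monoid algebra over S of the free monoid on I. *)
Definition free_alg : Type := {malg S[{fmonom I}]}.

HB.instance Definition _ := GRing.Lalgebra.on free_alg.

Fact free_scaleAr (a : S) (x y : free_alg) : a *: (x * y) = x * (a *: y).
Proof.
have comm_a (z : free_alg) : z * (malgC a : free_alg) = a *: z.
  rewrite -[RHS](mul_malgC a z) [LHS]fgmulgU [RHS]fgmulUg.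
  by apply: eq_bigr => m _; rewrite mul1m mulm1 mulrC.
by rewrite -!comm_a mulrA.
Qed.
HB.instance Definition _ := GRing.Lalgebra_isAlgebra.Build S free_alg
  free_scaleAr.

Definition free_gen (i : I) : free_alg := mkmalgU (fmu i) 1.

End FreeAlgebra.

Definition ideal_gen (A : nzRingType) (E : A -> Prop) (x : A) : Prop :=
  forall I : A -> Prop, two_sided_ideal I -> (forall y, E y -> I y) -> I x.

Lemma ideal_gen_two_sided (A : nzRingType) (E : A -> Prop) :
  two_sided_ideal (ideal_gen E).
Proof.
split=> [I [] //|x y Ex Ey I II EI|a x Ex I II EI|a x Ex I II EI].
- by apply: idealD => //; [apply: Ex|apply: Ey].
- by apply: idealMl => //; apply: Ex.
- by apply: idealMr => //; apply: Ex.
Qed.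

Definition ideal_gen_proper (A : nzRingType) (E : A -> Prop)
    (E1 : ~ ideal_gen E 1) : proper_ideal A :=
  ProperIdeal (ideal_gen_two_sided E) E1.

(* A viewed as a k-algebra through k -> k[t]; a separate carrier, since A is
   already a module over k[t]. *)
Definition res_scalars (k : comNzRingType) (A : algType {poly k}) : Type := A.

Section RestrictScalars.
Variables (k : comNzRingType) (A : algType {poly k}).
HB.instance Definition _ := GRing.NzRing.on (res_scalars A).

Definition res_scale (a : k) (x : res_scalars A) : res_scalars A :=
  a%:P *: (x : A).

Fact res_scaleA a b x : res_scale a (res_scale b x) = res_scale (a * b) x.
Proof. by rewrite /res_scale scalerA polyCM. Qed.
Fact res_scale1 : left_id 1 res_scale.
Proof. by move=> x; rewrite /res_scale scale1r. Qed.
Fact res_scaleDr : right_distributive res_scale +%R.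
Proof. by move=> a x y; rewrite /res_scale scalerDr. Qed.
Fact res_scaleDl x : {morph res_scale^~ x : a b / a + b}.
Proof. by move=> a b; rewrite /res_scale polyCD scalerDl. Qed.
HB.instance Definition _ := GRing.Zmodule_isLmodule.Build k (res_scalars A)
  res_scaleA res_scale1 res_scaleDr res_scaleDl.

Fact res_scaleAl (a : k) (x y : res_scalars A) : a *: (x * y) = a *: x * y.
Proof. exact: (@scalerAl _ A). Qed.
HB.instance Definition _ := GRing.Lmodule_isLalgebra.Build k (res_scalars A)
  res_scaleAl.

Fact res_scaleAr (a : k) (x y : res_scalars A) : a *: (x * y) = x * (a *: y).
Proof. exact: (@scalerAr _ A). Qed.
HB.instance Definition _ := GRing.Lalgebra_isAlgebra.Build k (res_scalars A)
  res_scaleAr.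
End RestrictScalars.

HB.mixin Record ComAlgebra_isPoisson (k : fieldType) R
    of GRing.ComAlgebra k R := {
  pbr : R -> R -> R;
  pbr_linearl : forall z, linear (pbr^~ z);
  pbr_linearr : forall x, linear (pbr x);
  pbrxx : forall x, pbr x x = 0;
  pbr_jacobi : forall x y z,
    pbr x (pbr y z) + pbr y (pbr z x) + pbr z (pbr x y) = 0;
  pbr_leibniz : forall a b c, pbr (a * b) c = a * pbr b c + pbr a c * b
}.

#[short(type="poissonAlgType")]
HB.structure Definition PoissonAlgebra (k : fieldType) :=
  {R of ComAlgebra_isPoisson k R & GRing.ComAlgebra k R}.

Definition poisson_isomorphic (k : fieldType) (R R' : poissonAlgType k) : Prop :=
  exists f : {lrmorphism R -> R'},
    bijective f /\ forall a b, f (pbr a b) = pbr (f a) (f b).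

(* The last clause says that A / hA is commutative. *)
Record regular_element (A : nzRingType) (h : A) : Prop := {
  reg_neq0 : h <> 0;
  reg_nonunit : ~ exists b, b * h = 1 /\ h * b = 1;
  reg_nzd : forall a, (h * a = 0 -> a = 0) /\ (a * h = 0 -> a = 0);
  reg_central : forall a, h * a = a * h;
  reg_quot_comm : forall a b, exists c, a * b - b * a = h * c
}.

Section SemiclassicalLimit.
Variables (k : fieldType) (A : algType k) (h : A).
Hypothesis hreg : regular_element h.

Definition principal_ideal (x : A) : Prop := exists a, x = h * a.

Fact principal_two_sided : two_sided_ideal principal_ideal.
Proof.
split=> [|_ _ [a ->] [b ->]|a _ [b ->]|a _ [b ->]].
- by exists 0; rewrite mulr0.
- by exists (a + b); rewrite mulrDr.
- by exists (a * b); rewrite !mulrA (reg_central hreg).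
- by exists (b * a); rewrite mulrA.
Qed.

Fact principal_proper : ~ principal_ideal 1.
Proof.
move=> [b hb]; apply: (reg_nonunit hreg); exists b.
by rewrite -(reg_central hreg) -hb.
Qed.

Definition reg_ideal : proper_ideal A :=
  ProperIdeal principal_two_sided principal_proper.

Definition semiclassical_limit : Type := quot_alg reg_ideal.
Local Notation Q := semiclassical_limit.
HB.instance Definition _ := GRing.Algebra.on Q.

Local Notation pi := (quot_pi reg_ideal : A -> Q).

Fact semiclassical_mulC : commutative ( *%R : Q -> Q -> Q).
Proof.
move=> x y; rewrite -(quot_pi_repr x) -(quot_pi_repr y) -!rmorphM.
apply/quot_pi_eq; exact: reg_quot_comm.
Qed.
HB.instance Definition _ := GRing.PzRing_hasCommutativeMul.Build Q
  semiclassical_mulC.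

(* h^-1 (ab - ba), which is unique as h is not a zero divisor. *)
Definition hcomm (a b : A) : A := projT1 (cid (reg_quot_comm hreg a b)).

Definition semiclassical_bracket (x y : Q) : Q := pi (hcomm (repr x) (repr y)).

Lemma hcommE a b : a * b - b * a = h * hcomm a b.
Proof. exact: (projT2 (cid (reg_quot_comm hreg a b))). Qed.

Lemma reg_lreg : injective ( *%R h).
Proof.
move=> x y hxy; apply/eqP; rewrite -subr_eq0; apply/eqP.
by apply: (reg_nzd hreg _).1; rewrite mulrBr hxy subrr.
Qed.

Lemma reg_mulCA a x : a * (h * x) = h * (a * x).
Proof. by rewrite !mulrA (reg_central hreg). Qed.

Lemma hcomm_linearr a : linear (hcomm a).
Proof.
move=> s x y; apply: reg_lreg; rewrite mulrDr -scalerAr -!hcommE.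
rewrite mulrDr mulrDl scalerBr -scalerAr -scalerAl opprD !addrA.
by congr (_ - _); rewrite addrAC.
Qed.

Lemma hcommxx a : hcomm a a = 0.
Proof. by apply: reg_lreg; rewrite -hcommE subrr mulr0. Qed.

Lemma hcommN a b : hcomm a b = - hcomm b a.
Proof. by apply: reg_lreg; rewrite mulrN -!hcommE opprB. Qed.

Lemma hcommMl a b c : hcomm (a * b) c = a * hcomm b c + hcomm a c * b.
Proof.
apply: reg_lreg; rewrite mulrDr [h * (_ * b)]mulrA -reg_mulCA -!hcommE.
by rewrite mulrBr mulrBl !mulrA addrA subrK.
Qed.

Lemma hcommhr a b : hcomm a (h * b) = h * hcomm a b.
Proof.
by apply: reg_lreg; rewrite -!hcommE mulrBr !reg_mulCA !mulrA.
Qed.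

Lemma hhcommE a b c :
  h * (h * hcomm a (hcomm b c))
  = (a * b * c - a * c * b) - (b * c * a - c * b * a).
Proof.
set u := hcomm b c; rewrite -hcommE mulrBr -(reg_mulCA a) [h * (u * a)]mulrA.
by rewrite -hcommE mulrBr mulrBl !mulrA.
Qed.

Fact zmod_jacobi (V : zmodType) (p q r s u v : V) :
  (p - q - (r - s)) + (r - u - (v - q)) + (v - s - (p - u)) = 0.
Proof.
rewrite !opprB !addrA [LHS](ACl ((1*12)*(2*7)*(3*10)*(4*5)*(6*11)*(8*9))) /=.
by rewrite !subrr !addNr !addr0.
Qed.

Lemma hcomm_jacobi a b c :
  hcomm a (hcomm b c) + hcomm b (hcomm c a) + hcomm c (hcomm a b) = 0.
Proof.
do 2 apply: reg_lreg; rewrite !mulr0 !mulrDr !hhcommE; exact: zmod_jacobi.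
Qed.

Lemma semiclassical_bracketE a b :
  semiclassical_bracket (pi a) (pi b) = pi (hcomm a b).
Proof.
have hcommr x y y' : principal_ideal (y' - y) ->
    principal_ideal (hcomm x y' - hcomm x y).
  move=> [z Dz]; exists (hcomm x z).
  have -> : y' = h * z + y by rewrite -Dz subrK.
  have := hcomm_linearr x 1 (h * z) y; rewrite !scale1r => ->.
  by rewrite addrK hcommhr.
apply/quot_pi_eq; set a' := repr _; set b' := repr _.
have [_ iD iMl _] := principal_two_sided.
have -> : hcomm a' b' - hcomm a b
    = (hcomm a' b' - hcomm a' b) + (-1) * (hcomm b a' - hcomm b a).
  rewrite mulN1r [hcomm b a']hcommN [hcomm b a]hcommN !opprD !opprK.
  by rewrite addrA subrK.
apply: iD; [|apply: iMl]; apply: hcommr; exact: (quot_reprB reg_ideal).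
Qed.

Fact semiclassical_linearr x : linear (semiclassical_bracket x).
Proof.
move=> s y z.
rewrite -(quot_pi_repr x) -(quot_pi_repr y) -(quot_pi_repr z).
by rewrite -linearP !semiclassical_bracketE hcomm_linearr linearP.
Qed.

Fact semiclassicalN x y :
  semiclassical_bracket x y = - semiclassical_bracket y x.
Proof.
rewrite -(quot_pi_repr x) -(quot_pi_repr y) !semiclassical_bracketE.
by rewrite hcommN rmorphN.
Qed.

Fact semiclassical_linearl z : linear (semiclassical_bracket^~ z).
Proof.
move=> s x y; rewrite semiclassicalN semiclassical_linearr opprD -scalerN.
by rewrite -!semiclassicalN.
Qed.

Fact semiclassicalxx x : semiclassical_bracket x x = 0.
Proof.
by rewrite -(quot_pi_repr x) semiclassical_bracketE hcommxx rmorph0.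
Qed.

Fact semiclassical_jacobi x y z :
  semiclassical_bracket x (semiclassical_bracket y z)
  + semiclassical_bracket y (semiclassical_bracket z x)
  + semiclassical_bracket z (semiclassical_bracket x y) = 0.
Proof.
rewrite -(quot_pi_repr x) -(quot_pi_repr y) -(quot_pi_repr z).
by rewrite !semiclassical_bracketE -!rmorphD hcomm_jacobi rmorph0.
Qed.

Fact semiclassical_leibniz x y z :
  semiclassical_bracket (x * y) z
  = x * semiclassical_bracket y z + semiclassical_bracket x z * y.
Proof.
rewrite -(quot_pi_repr x) -(quot_pi_repr y) -(quot_pi_repr z).
by rewrite -rmorphM !semiclassical_bracketE -!rmorphM -rmorphD -hcommMl.
Qed.

HB.instance Definition _ := ComAlgebra_isPoisson.Build k Q
  semiclassical_linearl semiclassical_linearr semiclassicalxx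
  semiclassical_jacobi semiclassical_leibniz.

End SemiclassicalLimit.

(* Indices are shifted by one: with l : 'I_n standing for l.+1, the 1-based
   indices 2l-1 and 2l are oddix l and evenix l, of values 2l and 2l+1. *)
Fact oddix_proof n (l : 'I_n) : (l.*2 < n.*2)%N.
Proof. by rewrite ltn_double. Qed.
Fact evenix_proof n (l : 'I_n) : (l.*2.+1 < n.*2)%N.
Proof. by rewrite ltn_Sdouble. Qed.
Definition oddix n (l : 'I_n) : 'I_n.*2 := Ordinal (oddix_proof l).
Definition evenix n (l : 'I_n) : 'I_n.*2 := Ordinal (evenix_proof l).

Section Jacobiator.
Variables (k : comNzRingType) (R : comAlgType k) (br : R -> R -> R).
Hypotheses (br_linearr : forall x, linear (br x))
  (brN : forall x y, br x y = - br y x)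
  (br_leibniz : forall x y z, br (x * y) z = x * br y z + br x z * y).

Definition jacobiator (x y z : R) :=
  br x (br y z) + br y (br z x) + br z (br x y).

Lemma jacobiatorC x y z : jacobiator x y z = jacobiator y z x.
Proof. by rewrite /jacobiator -addrA addrC. Qed.

Lemma jacobiatorP c x x' y z :
  jacobiator (c *: x + x') y z = c *: jacobiator x y z + jacobiator x' y z.
Proof.
have linl w : linear (br^~ w).
  by move=> a u v; rewrite brN br_linearr opprD -scalerN -!brN.
rewrite /jacobiator !(br_linearr, linl) !scalerDr.
set a1 := c *: _; set a2 := c *: _; set a3 := c *: _.
by rewrite [RHS]addrACA; congr (_ + _); rewrite addrACA.
Qed.

Lemma jacobiatorM x x' y z :
  jacobiator (x * x') y z = x * jacobiator x' y z + jacobiator x y z * x'.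
Proof.
have brD u v w : br u (v + w) = br u v + br u w.
  by have := br_linearr u 1 v w; rewrite !scale1r.
have leibr u v w : br w (u * v) = u * br w v + br w u * v.
  by rewrite brN br_leibniz [br w v]brN [br w u]brN opprD mulrN mulNr.
rewrite /jacobiator br_leibniz !leibr br_leibniz !brD !leibr.
rewrite [br x y]brN [br x' y]brN.
ring.
Qed.

Lemma jacobiator1 y z : jacobiator 1 y z = 0.
Proof.
have := jacobiatorM 1 1 y z; rewrite !mul1r !mulr1 => /eqP.
by rewrite -subr_eq0 opprD addrA subrr sub0r oppr_eq0 => /eqP.
Qed.
End Jacobiator.

Lemma mpoly_gen_ind (k : comNzRingType) (n : nat) (P : {mpoly k[n]} -> Prop) :
  P 1 -> (forall c p q, P p -> P q -> P (c *: p + q)) ->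
  (forall p q, P p -> P q -> P (p * q)) ->
  (forall i, P 'X_i) -> forall p, P p.
Proof.
move=> P1 PL PM PX.
have P0 : P 0 by have := PL (-1) 1 1 P1 P1; rewrite scaleN1r addNr.
apply: (@mpolyind n k P P0) => c m p _ _ Pp; apply: (PL) Pp.
rewrite mpolyXE_id; apply: (@big_ind _ P) => // i _.
by elim: (m i) => [|e IHe]; rewrite ?expr0 // exprS; apply: PM.
Qed.

Definition poisson_weyl (k : fieldType) (n : nat) : Type := {mpoly k[n.*2]}.

Section PoissonWeyl.
Variables (k : fieldType) (n : nat).
Local Notation B := {mpoly k[n.*2]}.
HB.instance Definition _ := GRing.ComAlgebra.on (poisson_weyl k n).

Definition weyl_bracket (f g : B) : B :=
  \sum_(l < n) (- (f^`M(oddix l) * g^`M(evenix l))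
                + g^`M(oddix l) * f^`M(evenix l)).

Fact weyl_bracketN f g : weyl_bracket f g = - weyl_bracket g f.
Proof. by rewrite -sumrN; apply: eq_bigr => l _; rewrite opprD opprK addrC. Qed.

Fact weyl_bracketxx f : weyl_bracket f f = 0.
Proof. by rewrite /weyl_bracket big1 // => l _; rewrite addNr. Qed.

Fact weyl_bracket_linearr f : linear (weyl_bracket f).
Proof.
move=> c g h; rewrite scaler_sumr -big_split; apply: eq_bigr => l _ /=.
rewrite !mderivD !mderivZ -!mul_mpolyC; ring.
Qed.

Fact weyl_bracket_linearl g : linear (weyl_bracket^~ g).
Proof.
move=> c f h; rewrite weyl_bracketN weyl_bracket_linearr opprD -scalerN.
by rewrite -!weyl_bracketN.
Qed.

Fact weyl_bracket_leibniz f g h :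
  weyl_bracket (f * g) h = f * weyl_bracket g h + weyl_bracket f h * g.
Proof.
rewrite mulr_sumr mulr_suml -big_split; apply: eq_bigr => l _ /=.
rewrite !mderivM; ring.
Qed.

Fact weyl_bracket_jacobi f g h :
  weyl_bracket f (weyl_bracket g h) + weyl_bracket g (weyl_bracket h f)
  + weyl_bracket h (weyl_bracket f g) = 0.
Proof.
have bC x c : weyl_bracket x c%:MP = 0.
  rewrite /weyl_bracket big1 // => l _; rewrite !mderivC; ring.
have bXX i j : exists c, weyl_bracket 'X_i 'X_j = c%:MP.
  have dX (a b : 'I_n.*2) : exists c, ('X_a : {mpoly k[n.*2]})^`M(b) = c%:MP.
    rewrite mderivX; case: (eqVneq a b) => [->|ab].
      exists 1; rewrite mnm1E eqxx scale1r mpolyC1 -mpolyX0; congr 'X_[_].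
      by apply/mnmP=> z; rewrite mnmBE mnm0E subnn.
    by exists 0; rewrite mnm1E (negPf ab) scale0r mpolyC0.
  rewrite /weyl_bracket; elim/big_ind: _ => [|_ _ [a ->] [b ->]|l _].
  - by exists 0; rewrite mpolyC0.
  - by exists (a + b); rewrite mpolyCD.
  have [a ->] := dX i (oddix l); have [b ->] := dX j (evenix l).
  have [c ->] := dX j (oddix l); have [d ->] := dX i (evenix l).
  by exists (- (a * b) + c * d); rewrite mpolyCD mpolyCN !mpolyCM.
have ext g' h' : (forall i, jacobiator weyl_bracket 'X_i g' h' = 0) ->
    forall f', jacobiator weyl_bracket f' g' h' = 0.
  apply: mpoly_gen_ind.
  - exact: (jacobiator1 weyl_bracket_linearr weyl_bracketN
              weyl_bracket_leibniz).
  - move=> c x y Jx Jy.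
    rewrite (jacobiatorP weyl_bracket_linearr weyl_bracketN) Jx Jy.
    by rewrite scaler0 addr0.
  - move=> x y Jx Jy.
    rewrite (jacobiatorM weyl_bracket_linearr weyl_bracketN
               weyl_bracket_leibniz).
    by rewrite Jx Jy mulr0 mul0r addr0.
rewrite -/(jacobiator weyl_bracket f g h).
move: f; apply: (ext) => i; rewrite jacobiatorC.
move: g; apply: (ext) => j; rewrite jacobiatorC.
move: h; apply: (ext) => l; rewrite /jacobiator.
have [a ->] := bXX i j; have [b ->] := bXX j l; have [c ->] := bXX l i.
by rewrite !bC !addr0.
Qed.

HB.instance Definition _ := ComAlgebra_isPoisson.Build k (poisson_weyl k n)
  weyl_bracket_linearl weyl_bracket_linearr weyl_bracketxx
  weyl_bracket_jacobi weyl_bracket_leibniz.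

End PoissonWeyl.

Fact rmorph_relation (A B : nzRingType) (f : {rmorphism A -> B}) x y z :
  f x = 0 -> f y = 0 -> f z = 0 -> f (x * y - (y * x + z)) = 0.
Proof.
by move=> fx fy fz; rewrite rmorphB rmorphD !rmorphM fx fy fz !mul0r addr0 subr0.
Qed.

Section QuantizedWeyl.
Import monalg.
Variables (k : fieldType) (n : nat).
Local Notation F := (free_alg {poly k} 'I_n.*2).
Local Notation X := (@free_gen {poly k} 'I_n.*2).

Definition weyl_relation (r : F) : Prop :=
  exists i j : 'I_n.*2, (i < j)%N /\
    r = X j * X i
        - (X i * X j
           + (if [exists l : 'I_n, (i == oddix l) && (j == evenix l)]
              then 'X%:A else 0)).

(* Setting t and all x_i to 0 kills the relations. *)
Definition weyl_augment_monom (m : fmonom 'I_n.*2) : k := (m == monalg.one)%:R.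

Fact weyl_augment_monomP : mmorphism weyl_augment_monom.
Proof.
split=> [x y|]; rewrite /weyl_augment_monom ?eqxx // fmM_eq1.
by rewrite -natrM mulnb.
Qed.
HB.instance Definition _ := isMultiplicative.Build _ _ weyl_augment_monom
  weyl_augment_monomP.

Fact weyl_augmentP : exists f : {rmorphism F -> k},
  (forall i, f (X i) = 0) /\ f ('X%:A) = 0.
Proof.
pose f : {rmorphism {malg {poly k}[{fmonom 'I_n.*2}]} -> k} :=
  mmap (horner_eval (0 : k)) weyl_augment_monom.
exists f; split=> [i|].
  by rewrite /f /= mmapU /weyl_augment_monom fm1_eq1 mulr0.
have -> : f ('X%:A) = horner_eval (0 : k) 'X * f 1 by exact: mmapZ.
by rewrite horner_evalE hornerX mul0r.
Qed.

Fact weyl_relation_proper : ~ ideal_gen weyl_relation 1.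
Proof.
have [f [fX ft]] := weyl_augmentP.
have kerI : two_sided_ideal (fun x : F => f x = 0).
  split=> [|x y fx fy|a x fx|a x fx]; first exact: rmorph0.
  - by rewrite rmorphD fx fy addr0.
  - by rewrite rmorphM fx mulr0.
  - by rewrite rmorphM fx mul0r.
move/(_ _ kerI); rewrite rmorph1 => f1; have /eqP[] := oner_neq0 k.
apply: f1 => _ [i [j [_ ->]]].
apply: rmorph_relation => //; by case: ifP => // _; exact: rmorph0.
Qed.

Definition weyl_alg : Type := quot_alg (ideal_gen_proper weyl_relation_proper).
HB.instance Definition _ := GRing.Algebra.on weyl_alg.

Definition weyl_gen (i : 'I_n.*2) : weyl_alg := quot_pi _ (X i).

Definition weyl_t : res_scalars weyl_alg := ('X%:A : weyl_alg).

End QuantizedWeyl.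

Record derivation (S : comNzRingType) (R : algType S) := Derivation {
  der :> {linear R -> R};
  derM : forall a b, der (a * b) = der a * b + a * der b
}.

(* R[z; nu] is the free left R-module {poly R}, with z = 'X, equipped with
   the product (sum_i a_i z^i) q = sum_i a_i (z^i q), where left multiplication
   by z is q |-> q z + nu(q), nu acting coefficientwise. *)
Definition skewpoly (S : comNzRingType) (R : algType S) (nu : derivation R)
  : Type := {poly R}.

Section SkewPoly.
Variables (S : comNzRingType) (R : algType S) (nu : derivation R).
Implicit Types p q r : {poly R}.
Local Notation T := (skewpoly nu).
HB.instance Definition _ := GRing.Zmodule.on T.

Definition skew_shift p : {poly R} := p * 'X + map_poly nu p.
Definition skew_mul p q : {poly R} :=
  \sum_(i < size p) p`_i *: iter i skew_shift q.

Lemma map_der p i : (map_poly nu p)`_i = nu p`_i.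
Proof. by rewrite coef_map_id0 ?raddf0. Qed.

Fact der1 : nu 1 = 0.
Proof.
have := derM nu 1 1; rewrite !mulr1 mul1r => /eqP.
by rewrite -subr_eq0 opprD addrA subrr sub0r oppr_eq0 => /eqP.
Qed.

Lemma skew_shift_zmod_morphism : zmod_morphism skew_shift.
Proof.
move=> p q; apply/polyP=> i.
by rewrite !(coefD, coefB, coefN, coefMX, map_der) raddfB; case: i => [|i] /=;
  rewrite ?sub0r ?oppr0 ?add0r ?coefB // opprD addrACA.
Qed.
HB.instance Definition _ := GRing.isZmodMorphism.Build {poly R} {poly R}
  skew_shift skew_shift_zmod_morphism.

Lemma skew_shiftZ a p : skew_shift (a *: p) = a *: skew_shift p + nu a *: p.
Proof.
apply/polyP=> i; rewrite !(coefD, coefMX, coefZ, map_der, derM) mulrDr.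
case: i => [|i] /=; first by rewrite mulr0 !add0r addrC.
by rewrite -addrA [X in _ + X]addrC.
Qed.

Lemma skew_mulE n p q : (size p <= n)%N ->
  skew_mul p q = \sum_(i < n) p`_i *: iter i skew_shift q.
Proof.
move=> le_pn; rewrite /skew_mul.
rewrite (big_ord_widen n (fun i => p`_i *: iter i skew_shift q)) //.
rewrite big_mkcond; apply: eq_bigr => i _; case: ltnP => // le_pi.
by rewrite nth_default // scale0r.
Qed.

Lemma iter_shift_is_additive i : zmod_morphism (iter i skew_shift).
Proof. by elim: i => [|i IHi] p q //=; rewrite IHi raddfB. Qed.
HB.instance Definition _ i := GRing.isZmodMorphism.Build {poly R} {poly R}
  (iter i skew_shift) (iter_shift_is_additive i).

Lemma skew_mulDl : left_distributive skew_mul +%R.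
Proof.
move=> p q r; pose n := maxn (size p) (size q).
rewrite !(@skew_mulE n) ?leq_maxl ?leq_maxr ?size_polyD // -big_split.
by apply: eq_bigr => i _; rewrite coefD scalerDl.
Qed.

Lemma skew_mulDr : right_distributive skew_mul +%R.
Proof.
move=> p q r; rewrite /skew_mul -big_split.
by apply: eq_bigr => i _; rewrite raddfD scalerDr.
Qed.

Lemma skew_mulZl a p q : skew_mul (a *: p) q = a *: skew_mul p q.
Proof.
rewrite (@skew_mulE (size p)) ?size_scale_leq // scaler_sumr.
by apply: eq_bigr => i _; rewrite coefZ scalerA.
Qed.

Lemma skew_mul_shift p q : skew_mul (skew_shift p) q = skew_shift (skew_mul p q).
Proof.
rewrite /skew_shift -/(skew_shift (skew_mul p q)) skew_mulDl.
have le_pX : (size (p * 'X)%R <= (size p).+1)%N.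
  by rewrite (leq_trans (size_polyMleq _ _)) // size_polyX addn2.
rewrite (skew_mulE _ le_pX) big_ord_recl coefMX scale0r add0r.
rewrite (@skew_mulE (size p) (map_poly nu p)) ?size_poly //.
rewrite raddf_sum -big_split; apply: eq_bigr => i _ /=.
by rewrite coefMX map_der skew_shiftZ.
Qed.

Fact skew_mulA : associative skew_mul.
Proof.
move=> p q r; rewrite {1}/skew_mul {3}/skew_mul.
have mul0 : skew_mul 0 r = 0 by rewrite /skew_mul size_poly0 big_ord0.
rewrite (big_morph (skew_mul^~ r) (fun x y => skew_mulDl x y r) mul0).
apply: eq_bigr => i _; rewrite skew_mulZl; congr (_ *: _).
by elim: (i : nat) => //= j ->; rewrite skew_mul_shift.
Qed.

Fact skew_mul1 : left_id (1 : {poly R}) skew_mul.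
Proof.
by move=> p; rewrite (@skew_mulE 1) ?size_poly1 // big_ord1 coef1 scale1r.
Qed.

Lemma iter_shift1 i : iter i skew_shift 1 = 'X^i.
Proof.
elim: i => //= i ->; rewrite exprSr /skew_shift -[RHS]addr0; congr (_ + _).
apply/polyP=> j; rewrite map_der coefXn coef0.
by case: (j == i); rewrite ?raddf0 ?der1.
Qed.

Fact skew_mulr1 : right_id (1 : {poly R}) skew_mul.
Proof.
move=> p; rewrite -[RHS]coefK poly_def; apply: eq_bigr => i _.
by rewrite iter_shift1.
Qed.

HB.instance Definition _ := GRing.Zmodule_isNzRing.Build T
  skew_mulA skew_mul1 skew_mulr1 skew_mulDl skew_mulDr (oner_neq0 {poly R}).

Definition skew_scale (s : S) (p : T) : T := (s%:A : R) *: (p : {poly R}).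

Fact skew_scaleA a b p : skew_scale a (skew_scale b p) = skew_scale (a * b) p.
Proof. by rewrite /skew_scale scalerA -scalerAl mul1r scalerA. Qed.
Fact skew_scale1 : left_id 1 skew_scale.
Proof. by move=> p; rewrite /skew_scale !scale1r. Qed.
Fact skew_scaleDr : right_distributive skew_scale +%R.
Proof. by move=> a p q; rewrite /skew_scale scalerDr. Qed.
Fact skew_scaleDl p : {morph skew_scale^~ p : a b / a + b}.
Proof. by move=> a b; rewrite /skew_scale !scalerDl. Qed.
HB.instance Definition _ := GRing.Zmodule_isLmodule.Build S T
  skew_scaleA skew_scale1 skew_scaleDr skew_scaleDl.

Fact skew_scaleAl (a : S) (p q : T) : a *: (p * q) = a *: p * q.
Proof. by symmetry; apply: skew_mulZl. Qed.
HB.instance Definition _ := GRing.Lmodule_isLalgebra.Build S T skew_scaleAl.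

Fact skew_scaleAr (a : S) (p q : T) : a *: (p * q) = p * (a *: q).
Proof.
have shiftZ i : iter i skew_shift ((a%:A : R) *: (q : {poly R}))
    = (a%:A : R) *: iter i skew_shift q.
  elim: i => //= i ->; rewrite skew_shiftZ linearZ /= der1 scaler0 scale0r.
  by rewrite addr0.
rewrite [LHS]scaler_sumr; apply: eq_bigr => i _; rewrite shiftZ !scalerA.
have scaleE (r : {poly R}) : (a *: (r : T) : T) = (a%:A : R) *: r by [].
by rewrite [LHS]scaleE scalerA mulr_algl mulr_algr.
Qed.
HB.instance Definition _ := GRing.Lalgebra_isAlgebra.Build S T skew_scaleAr.

Definition skewC (a : R) : T := a%:P.
Definition skewX : T := 'X.

Lemma skewXC a : skewX * skewC a = skewC a * skewX + skewC (nu a).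
Proof.
have -> : skewX * skewC a = skew_mul 'X a%:P by [].
rewrite (@skew_mulE 2) ?size_polyX // big_ord_recl big_ord1 coefX scale0r add0r.
rewrite coefX scale1r /= /skew_shift map_polyC; congr (_ + _).
have -> : skewC a * skewX = skew_mul a%:P 'X by [].
by rewrite (@skew_mulE 1) ?size_polyC_leq1 // big_ord1 coefC mul_polyC.
Qed.

End SkewPoly.

Arguments skewX {S R nu}.

Section PartialDerivation.
Variables (S : comNzRingType) (R : algType S).

Fact zero_derM (a b : R) :
  (\0 : {linear R -> R}) (a * b)
  = (\0 : {linear R -> R}) a * b + a * (\0 : {linear R -> R}) b.
Proof. by rewrite /= mul0r mulr0 addr0. Qed.
Definition zero_der : derivation R := Derivation zero_derM.

Lemma skew_zeroM (p q : skewpoly zero_der) :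
  p * q = (p : {poly R}) * (q : {poly R}) :> {poly R}.
Proof.
have shift0 (r : {poly R}) : skew_shift zero_der r = r * 'X.
  rewrite /skew_shift; set r' := map_poly _ _.
  suff -> : r' = 0 by rewrite addr0.
  by apply/polyP=> j; rewrite map_der coef0.
have shiftE (r : {poly R}) i : iter i (skew_shift zero_der) r = r * 'X^i.
  elim: i => [|i IHi] /=; first by rewrite mulr1.
  by rewrite IHi shift0 exprSr mulrA.
rewrite -{2}[p : {poly R}]coefK poly_def mulr_suml.
by apply: eq_bigr => i _; rewrite shiftE -scalerAl commr_polyXn.
Qed.

(* t d/dz on R[z]. *)
Section ScaledPartial.
Variable t : S.
Local Notation Rz := (skewpoly zero_der).

Definition scaled_partial (p : Rz) : Rz := t *: (p^`() : Rz).

Fact scaled_partial_linear : linear scaled_partial.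
Proof.
move=> a p q; rewrite /scaled_partial.
have -> : (a *: p + q)^`() = a *: (p^`() : Rz) + q^`() :> Rz.
  by rewrite derivD derivZ.
by rewrite scalerDr !scalerA mulrC.
Qed.
HB.instance Definition _ := GRing.isLinear.Build S Rz Rz *:%R scaled_partial
  scaled_partial_linear.

Fact scaled_partialM (p q : Rz) :
  scaled_partial (p * q) = scaled_partial p * q + p * scaled_partial q.
Proof.
rewrite /scaled_partial -scalerAl -scalerAr -scalerDr; congr (_ *: _).
by rewrite !skew_zeroM derivM.
Qed.
Definition scaled_partial_der : derivation Rz := Derivation scaled_partialM.
End ScaledPartial.
End PartialDerivation.


Section Tower.
Variables (S : comNzRingType) (t : S).

(* S[x_1][x_2; t d/dx_1] ... [x_(2n-1)][x_2n; t d/dx_(2n-1)], two variables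
   being added at each step. *)
Fixpoint weyl_tower (n : nat) : algType S :=
  if n is m.+1 then skewpoly (scaled_partial_der (weyl_tower m) t) else S^o.

(* weyl_tower m [x_(2m+1)], the domain of nu_(2m+2) = t d/dx_(2m+1). *)
Definition weyl_tower_odd (m : nat) : algType S :=
  skewpoly (zero_der (weyl_tower m)).

Definition weyl_nu (m : nat) : derivation (weyl_tower_odd m) :=
  scaled_partial_der (weyl_tower m) t.

(* The 0-based i-th variable; the value is irrelevant when i is too large. *)
Definition odd_var (m : nat) (v : nat -> weyl_tower m) (i : nat) :
  weyl_tower_odd m := if (i < m.*2)%N then skewC _ (v i) else skewX.

Fixpoint tower_var (n : nat) (i : nat) : weyl_tower n :=
  match n with
  | 0 => 0
  | m.+1 => if (i < m.*2.+1)%N then skewC _ (odd_var (tower_var m) i) else skewX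
  end.

Definition tower_odd_var (m : nat) (i : nat) : weyl_tower_odd m :=
  odd_var (tower_var m) i.

End Tower.

(* Main.v *)
(* The universal properties of the presented algebra A_n and of the iterated
   skew polynomial tower give mutually inverse maps between them; in particular
   A_n embeds in a free k[t]-module, so t is not a zero divisor. Commutators lie
   in tA_n because they do on generators. Sending t to 0 and x_i to the i-th
   variable gives A_n -> k[x_1,...,x_2n], which factors through A_n/tA_n; the
   substitution X_i |-> x_i is inverse to it, and both brackets agree on the
   generators, hence everywhere by the Leibniz rule. *)
From HB Require Import structures.
From mathcomp Require Import all_boot all_algebra.
From mathcomp Require monalg.
Require Import Defs.

Set Implicit Arguments.
Unset Strict Implicit.
Unset Printing Implicit Defensive.

Import GRing.Theory.
Local Open Scope ring_scope.

(** * Subalgebras and generating sets *)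

Record subalgebra (S : nzRingType) (A : algType S) (P : A -> Prop) : Prop := {
  subalg1 : P 1;
  subalgP : forall s x y, P x -> P y -> P (s *: x + y);
  subalgM : forall x y, P x -> P y -> P (x * y)
}.

(** Generation is phrased as an induction principle, so that an identity whose solutions form a
    subalgebra need only be checked on generators. *)
Definition generates (S : nzRingType) (A : algType S) (G : A -> Prop) : Prop :=
  forall P, subalgebra P -> (forall x, G x -> P x) -> forall x, P x.

Section Subalgebra.
Variables (S : nzRingType) (A : algType S) (P : A -> Prop).
Hypothesis sP : subalgebra P.

Lemma subalg0 : P 0.
Proof.
by rewrite -(addNr 1) -scaleN1r; apply: subalgP sP _ _ _ _ _; exact: subalg1.
Qed.

Lemma subalgZ s x : P x -> P (s *: x).
Proof.
by move=> Px; rewrite -[_ *: _]addr0; apply: (subalgP sP) => //; apply: subalg0.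
Qed.

Lemma subalgD x y : P x -> P y -> P (x + y).
Proof. by move=> Px Py; rewrite -[x]scale1r; apply: (subalgP sP). Qed.

Lemma subalg_preim (B : algType S) (f : {lrmorphism B -> A}) :
  subalgebra (fun x => P (f x)).
Proof.
split=> [|s x y Px Py|x y Px Py]; first by rewrite rmorph1; apply: subalg1.
- by rewrite linearP; apply: (subalgP sP).
- by rewrite rmorphM; apply: (subalgM sP).
Qed.
End Subalgebra.

Lemma equalizer_subalgebra (S : nzRingType) (A B : algType S)
    (f g : {lrmorphism A -> B}) : subalgebra (fun x => f x = g x).
Proof.
split=> [|s x y fx fy|x y fx fy]; rewrite ?rmorph1 //.
- by rewrite !linearP /= fx fy.
- by rewrite !rmorphM /= fx fy.
Qed.

Lemma lrmorphism_eq (S : nzRingType) (A B : algType S) (G : A -> Prop)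
    (f g : {lrmorphism A -> B}) :
  generates G -> (forall x, G x -> f x = g x) -> f =1 g.
Proof. by move=> genG; apply: genG; apply: equalizer_subalgebra. Qed.

(** Commutation with a fixed [z] is a derivation and scalars are central, so the elements whose
    commutator with [z] is a multiple of [s] form a subalgebra. Antisymmetry then allows the
    reduction to generators in each argument in turn. *)
Lemma generates_comm (S : comNzRingType) (A : algType S) (G : A -> Prop)
    (s : S) : generates G ->
  (forall x y, G x -> G y -> exists c : A, x * y - y * x = s *: c) ->
  forall x y, exists c : A, x * y - y * x = s *: c.
Proof.
move=> genG GP.
have sub z : subalgebra (fun x : A => exists c : A, x * z - z * x = s *: c).
  split=> [|r x y [c xc] [d yd]|x y [c xc] [d yd]].
  - by exists 0; rewrite mulr1 mul1r subrr scaler0.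
  - exists (r *: c + d); rewrite mulrDl mulrDr opprD addrACA.
    rewrite -scalerAl -scalerAr -scalerBr xc yd scalerDr !scalerA.
    by rewrite [r * s]mulrC.
  - exists (x * d + c * y); rewrite scalerDr scalerAr scalerAl -xc -yd.
    by rewrite mulrBr mulrBl !mulrA addrA subrK.
have swap x y : (exists c : A, x * y - y * x = s *: c) ->
    exists c : A, y * x - x * y = s *: c.
  by move=> [c xy]; exists (- c); rewrite scalerN -xy opprB.
move=> x y; apply: (genG _ (sub y)) x => x Gx.
by apply: swap; apply: (genG _ (sub x)) y => y Gy; apply: GP.
Qed.

(** * Universal properties of free algebras and quotients *)

Section FreeAlgebraTheory.
Import monalg.
Variables (S : comNzRingType) (I : choiceType).

(** An element is a finite sum of scalar multiples of words, and a word is a product of letters, by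
    induction on its length. *)
Lemma free_alg_generates :
  generates (fun x : free_alg S I => exists i, x = free_gen S i).
Proof.
move=> P sP PX x.
rewrite [x]monalgE.
apply: (big_ind P); [exact: (subalg0 sP)|exact: (subalgD sP)|].
move=> m _.
have -> : << x@_m *g m >> = x@_m *: (<< 1 *g m >> : free_alg S I).
  by rewrite -[RHS](mul_malgC (x@_m)) [RHS]fgmulUU mul1m mulr1.
apply: (subalgZ sP); case: m => s; elim: s => [|i s IHs].
  have -> : << 1 *g FMonom [::] >> = 1 :> free_alg S I.
    by rewrite -fmoneE.
  exact: (subalg1 sP).
have -> : << 1 *g FMonom (i :: s) >>
    = free_gen S i * (<< 1 *g FMonom s >> : free_alg S I).
  rewrite [RHS]fgmulUU mulr1; congr (<< _ *g _ >>).
  by apply/eqP; rewrite -val_eqE /= fmM fmU.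
by apply: (subalgM sP) => //; apply: PX; exists i.
Qed.

Variables (B : nzRingType) (c : {rmorphism S -> B}) (v : I -> B).
Hypothesis c_central : forall s b, GRing.comm (c s) b.

Definition fmonom_eval (m : fmonom I) : B := \prod_(i <- m) v i.

Fact fmonom_evalP : mmorphism fmonom_eval.
Proof.
by split=> [x y|]; rewrite /fmonom_eval ?fmM ?big_cat // fm1 big_nil.
Qed.
HB.instance Definition _ := isMultiplicative.Build _ _ fmonom_eval
  fmonom_evalP.

(** The target is a ring with a central morphism [c] from [S] instead of an [S]-algebra. This also
    covers the specialization at t = 0, whose target is only given as a [k]-algebra. *)
Lemma free_alg_lift : exists f : {rmorphism free_alg S I -> B},
  (forall i, f (free_gen S i) = v i) /\ forall s x, f (s *: x) = c s * f x.
Proof.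
pose f0 : free_alg S I -> B := mmap c fmonom_eval.
have fM : monoid_morphism f0.
  by have [] := @commr_mmap_is_multiplicative _ S B c fmonom_eval
    (fun g m m' => c_central _ _).
pose fA := GRing.isZmodMorphism.Build _ _ f0 (raddfB (mmap c fmonom_eval)).
pose fMM := GRing.isMonoidMorphism.Build _ _ f0 fM.
pose f : {rmorphism free_alg S I -> B} := HB.pack f0 fA fMM.
exists f; split=> [i|s x]; last exact: mmapZ.
by rewrite /f /= /f0 mmapU /= rmorph1 mul1r /fmonom_eval fmU big_seq1.
Qed.
End FreeAlgebraTheory.

Section QuotientLift.
Variables (S : nzRingType) (A : algType S) (I : proper_ideal A).
Variables (B : nzRingType) (f : {rmorphism A -> B}).
Hypothesis fI : forall x, I x -> f x = 0.

Lemma quot_alg_lift :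
  exists g : {rmorphism quot_alg I -> B}, forall x, g (quot_pi I x) = f x.
Proof.
pose g0 (x : quot_alg I) : B := f (repr x).
have g0E x : g0 (quot_pi I x) = f x.
  by apply/eqP; rewrite -subr_eq0 -rmorphB; apply/eqP/fI/quot_reprB.
have gA : zmod_morphism g0.
  move=> x y; rewrite -(quot_pi_repr x) -(quot_pi_repr y).
  by rewrite -raddfB !g0E raddfB.
have gM : monoid_morphism g0.
  split=> [|x y]; first by rewrite -(rmorph1 (quot_pi I)) g0E rmorph1.
  by rewrite -(quot_pi_repr x) -(quot_pi_repr y) -rmorphM !g0E rmorphM.
pose mA := GRing.isZmodMorphism.Build _ _ g0 gA.
pose mM := GRing.isMonoidMorphism.Build _ _ g0 gM.
pose g : {rmorphism quot_alg I -> B} := HB.pack g0 mA mM.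
by exists g.
Qed.
End QuotientLift.

Lemma lrmorph_if (S : nzRingType) (A B : algType S) (f : {lrmorphism A -> B})
    (b : bool) (s : S) :
  f (if b then s%:A else 0) = if b then s%:A else 0.
Proof. by case: b; rewrite ?linearZ ?rmorph1 ?rmorph0. Qed.

(* Stated for abstract rings because rewriting with the morphism laws directly
   in the free algebra triggers very slow unification. *)
Lemma rmorph_comm_relation (A B : nzRingType) (f : {rmorphism A -> B})
    (x y z w u : A) :
  f (x * y - (z * w + u)) = f x * f y - (f z * f w + f u).
Proof. by rewrite rmorphB rmorphD !rmorphM. Qed.

(** * The presented algebra: relations, generators, universal property *)

Section WeylAlgebraTheory.
Variables (k : fieldType) (n : nat).
Local Notation A := (weyl_alg k n).

Lemma weyl_gen_rel (i j : 'I_n.*2) : (i < j)%N ->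
  weyl_gen k j * weyl_gen k i = weyl_gen k i * weyl_gen k j
    + (if [exists l : 'I_n, (i == oddix l) && (j == evenix l)]
       then 'X%:A else 0) :> A.
Proof.
move=> lt_ij; rewrite -!rmorphM.
rewrite -(lrmorph_if (quot_pi (ideal_gen_proper (@weyl_relation_proper k n)))).
rewrite -rmorphD; apply/quot_pi_eq => I _; apply.
by exists i, j.
Qed.

Lemma weyl_alg_generates : generates (fun x : A => exists i, x = weyl_gen k i).
Proof.
move=> P sP PX x; have [y ->] := quot_pi_surj x.
apply: (free_alg_generates (subalg_preim sP _)) => _ [i ->].
by apply: PX; exists i.
Qed.

Section Lift.
Variables (B : nzRingType) (c : {rmorphism {poly k} -> B}) (v : 'I_n.*2 -> B).
Hypothesis c_central : forall s b, GRing.comm (c s) b.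
Hypothesis v_rel : forall i j : 'I_n.*2, (i < j)%N ->
  v j * v i = v i * v j
    + (if [exists l : 'I_n, (i == oddix l) && (j == evenix l)]
       then c 'X else 0).

Lemma weyl_alg_lift : exists f : {rmorphism A -> B},
  (forall i, f (weyl_gen k i) = v i) /\ forall s x, f (s *: x) = c s * f x.
Proof.
have [f [fX fZ]] := free_alg_lift v c_central.
have f_rel x : ideal_gen (@weyl_relation k n) x -> f x = 0.
  (* The kernel of [f] is one of the two-sided ideals over which [ideal_gen] quantifies, so only the
     defining relations remain to be checked. *)
  move=> /(_ (fun x => f x = 0)); apply.
    split=> [|y z fy fz|a y fy|a y fy].
    - exact: rmorph0.
    - by rewrite rmorphD fy fz addr0.
    - by rewrite rmorphM fy mulr0.
    - by rewrite rmorphM fy mul0r.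
  move=> _ [i [j [lt_ij ->]]]; rewrite rmorph_comm_relation !fX v_rel //.
  by case: ifP => _; rewrite ?fZ ?rmorph1 ?mulr1 ?rmorph0 subrr.
have [g gE] := @quot_alg_lift _ _
  (ideal_gen_proper (@weyl_relation_proper k n)) _ f f_rel.
exists g; split=> [i|s x]; first by rewrite gE fX.
by have [y ->] := quot_pi_surj x; rewrite -linearZ !gE fZ.
Qed.
End Lift.

Lemma weyl_alg_lift_lr (B : algType {poly k}) (v : 'I_n.*2 -> B) :
  (forall i j : 'I_n.*2, (i < j)%N -> v j * v i = v i * v j
    + (if [exists l : 'I_n, (i == oddix l) && (j == evenix l)]
       then 'X%:A else 0)) ->
  exists f : {lrmorphism A -> B}, forall i, f (weyl_gen k i) = v i.
Proof.
move=> v_rel.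
have c_central s (b : B) : GRing.comm (in_alg B s) b.
  by rewrite /GRing.comm /= mulr_algl mulr_algr.
have [f [fX fZ]] := weyl_alg_lift c_central v_rel.
have fZ' : scalable f by move=> s x; rewrite fZ /= mulr_algl.
pose fM := GRing.isScalable.Build _ _ _ _ f fZ'.
by pose g : {lrmorphism A -> B} := HB.pack (f : A -> B) f fM;
  exists g; exact: fX.
Qed.
End WeylAlgebraTheory.

(** * Generation and universal property of skew polynomial algebras *)

Section SkewPolyTheory.
Variables (S : comNzRingType) (R : algType S) (nu : derivation R).
Local Notation T := (skewpoly nu).
Local Notation skewC := (skewC nu).

Lemma skewC_mul a (p : T) : skewC a * p = a *: (p : {poly R}).
Proof.
have -> : skewC a * p = skew_mul nu a%:P p by [].
by rewrite (@skew_mulE _ _ _ 1) ?size_polyC_leq1 // big_ord1 coefC.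
Qed.

(** With coefficients on the left, the product is twisted only when z moves past a coefficient to
    its right; right multiplication by z is therefore the ordinary one. This makes Horner induction
    available in R[z; nu]. *)
Lemma skew_mulX (p : T) : p * skewX = (p : {poly R}) * 'X.
Proof.
have -> : p * skewX = skew_mul nu p 'X by [].
rewrite -{2}[p : {poly R}]coefK poly_def mulr_suml; apply: eq_bigr => i _.
(* Writing z as the shift of 1 turns z^i z into the (i+1)-st iterate on 1. *)
rewrite -[X in iter _ _ X](iter_shift1 nu 1).
by rewrite -iterSr iter_shift1 -scalerAl exprSr.
Qed.

Fact skewC_zmod_morphism : zmod_morphism skewC.
Proof. by move=> a b; apply: polyCB. Qed.
HB.instance Definition _ := GRing.isZmodMorphism.Build R T skewC
  skewC_zmod_morphism.
Fact skewC_monoid_morphism : monoid_morphism skewC.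
Proof. by split=> // a b; rewrite skewC_mul /skewC -mul_polyC polyCM. Qed.
HB.instance Definition _ := GRing.isMonoidMorphism.Build R T skewC
  skewC_monoid_morphism.
Fact skewC_scalable : scalable skewC.
Proof.
by move=> s a; rewrite -[LHS]mulr1 -mulr_algl rmorphM mulr1 skewC_mul.
Qed.
HB.instance Definition _ := GRing.isScalable.Build S R T *:%R skewC
  skewC_scalable.

Lemma skewpoly_generates (G : R -> Prop) : generates G ->
  generates (fun p : T => (exists2 a, G a & p = skewC a) \/ p = skewX).
Proof.
move=> genG P sP PG.
have PC a : P (skewC a).
  apply: (genG _ (subalg_preim sP skewC)) => b Gb.
  by apply: PG; left; exists b.
have PX : P skewX by apply: PG; right.
elim/poly_ind => [|p a Pp]; first exact: (subalg0 sP).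
by rewrite -skew_mulX; apply: (subalgD sP) (PC a); apply: (subalgM sP).
Qed.

Variables (B : algType S) (f : {lrmorphism R -> B}) (y : B).
Hypothesis y_rel : forall a, y * f a = f a * y + f (nu a).

Definition skew_eval (p : T) : B := \sum_(i < size p) f p`_i * y ^+ i.

Lemma skew_evalE m (p : T) : (size p <= m)%N ->
  skew_eval p = \sum_(i < m) f p`_i * y ^+ i.
Proof.
move=> le_pm; rewrite /skew_eval.
rewrite (big_ord_widen m (fun i => f p`_i * y ^+ i)) //.
rewrite big_mkcond; apply: eq_bigr => i _; case: ltnP => // le_pi.
by rewrite nth_default // rmorph0 mul0r.
Qed.

Fact skew_eval_zmod_morphism : zmod_morphism skew_eval.
Proof.
move=> p q; pose m := maxn (size p) (size q).
rewrite !(@skew_evalE m) ?leq_maxl ?leq_maxr //; last first.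
  by rewrite (leq_trans (size_polyD _ _)) // size_polyN.
by rewrite -sumrB; apply: eq_bigr => i _; rewrite coefB rmorphB mulrBl.
Qed.
HB.instance Definition _ := GRing.isZmodMorphism.Build T B skew_eval
  skew_eval_zmod_morphism.

Lemma skew_evalC a : skew_eval (skewC a) = f a.
Proof.
by rewrite (@skew_evalE 1) ?size_polyC_leq1 // big_ord1 coefC mulr1.
Qed.

Lemma skew_evalX : skew_eval skewX = y.
Proof.
rewrite (@skew_evalE 2) ?size_polyX // big_ord_recl big_ord1 !coefX.
by rewrite rmorph0 mul0r add0r rmorph1 mul1r.
Qed.

Lemma skew_evalZ a (p : {poly R}) :
  skew_eval (a *: p : {poly R}) = f a * skew_eval p.
Proof.
rewrite (@skew_evalE (size p)) ?size_scale_leq // mulr_sumr.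
by apply: eq_bigr => i _; rewrite coefZ rmorphM mulrA.
Qed.

(** The shift is left multiplication by z, and [y_rel] is exactly what makes it evaluate to left
    multiplication by [y]. Multiplicativity follows by iterating this. *)
Lemma skew_eval_shift (p : {poly R}) :
  skew_eval (skew_shift nu p) = y * skew_eval p.
Proof.
rewrite /skew_shift [LHS](raddfD skew_eval) /=.
have le_pX : (size (p * 'X)%R <= (size p).+1)%N.
  by rewrite (leq_trans (size_polyMleq _ _)) // size_polyX addn2.
rewrite (skew_evalE le_pX) big_ord_recl coefMX rmorph0 mul0r add0r.
rewrite (@skew_evalE (size p) (map_poly nu p)) ?size_poly //.
rewrite mulr_sumr -big_split; apply: eq_bigr => i _ /=.
by rewrite coefMX map_der mulrA y_rel mulrDl exprS mulrA.
Qed.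

Fact skew_eval_monoid_morphism : monoid_morphism skew_eval.
Proof.
split=> [|p q]; first by rewrite -(rmorph1 skewC) skew_evalC rmorph1.
have -> : p * q = skew_mul nu p q by [].
rewrite /skew_mul [LHS](raddf_sum skew_eval) mulr_suml.
apply: eq_bigr => i _ /=; rewrite skew_evalZ -mulrA; congr (_ * _).
elim: (i : nat) => [|j IHj] /=; first by rewrite mul1r.
by rewrite skew_eval_shift IHj mulrA exprS.
Qed.
HB.instance Definition _ := GRing.isMonoidMorphism.Build T B skew_eval
  skew_eval_monoid_morphism.
Fact skew_eval_scalable : scalable skew_eval.
Proof. by move=> s p; rewrite [LHS]skew_evalZ rmorph_alg mulr_algl. Qed.
HB.instance Definition _ := GRing.isScalable.Build S T B *:%R skew_eval
  skew_eval_scalable.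

Lemma skewpoly_lift : exists g : {lrmorphism T -> B},
  (forall a, g (skewC a) = f a) /\ g skewX = y.
Proof. by exists skew_eval; split; [exact: skew_evalC|exact: skew_evalX]. Qed.

End SkewPolyTheory.

Lemma generates_sub (S : nzRingType) (A : algType S) (G G' : A -> Prop) :
  (forall x, G x -> G' x) -> generates G -> generates G'.
Proof. by move=> sG genG P sP PG'; apply: genG => // x /sG; apply: PG'. Qed.

(** By the Leibniz rule, the hypothesis of [skewpoly_lift] can be verified on generators of [R]
    alone. *)
Lemma skew_relation_subalgebra (S : comNzRingType) (R B : algType S)
    (nu : derivation R) (f : {lrmorphism R -> B}) (y : B) :
  subalgebra (fun a => y * f a = f a * y + f (nu a)).
Proof.
split=> [|s a b ya yb|a b ya yb].
- by rewrite der1 !rmorph1 rmorph0 mulr1 mul1r addr0.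
- rewrite !linearP /= mulrDr mulrDl -scalerAr -scalerAl ya yb scalerDr.
  by rewrite addrACA.
- rewrite derM rmorphD !rmorphM /= mulrA ya mulrDl -mulrA yb mulrDr !mulrA.
  by rewrite addrAC -addrA.
Qed.

Lemma eq_derivation_subalgebra (S : comNzRingType) (R : algType S)
    (d d' : derivation R) : subalgebra (fun a => d a = d' a).
Proof.
split=> [|s a b da db|a b da db]; first by rewrite !der1.
- by rewrite !linearP /= da db.
- by rewrite !derM da db.
Qed.

(** * The iterated skew polynomial tower: generators, relations, universal property *)

Section TowerTheory.
Variables (S : comNzRingType) (t : S).

Lemma scaled_partialC (R : algType S) (a : R) :
  scaled_partial t (skewC _ a) = 0.
Proof. by rewrite /scaled_partial derivC scaler0. Qed.

Lemma scaled_partialX (R : algType S) :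
  scaled_partial t (skewX : skewpoly (zero_der R)) = t%:A.
Proof. by rewrite /scaled_partial derivX. Qed.

Lemma tower_odd_generates m :
  generates (fun x : weyl_tower t m =>
    exists2 i, (i < m.*2)%N & x = tower_var t m i) ->
  generates (fun x : weyl_tower_odd t m =>
    exists2 i, (i <= m.*2)%N & x = tower_odd_var t m i).
Proof.
move=> genT; apply: generates_sub (skewpoly_generates genT).
move=> _ [[_ [i lt_im ->] ->]|->].
  by exists i; [exact: ltnW|rewrite /tower_odd_var /odd_var lt_im].
by exists m.*2; rewrite // /tower_odd_var /odd_var ltnn.
Qed.

Lemma tower_generates m : generates (fun x : weyl_tower t m =>
  exists2 i, (i < m.*2)%N & x = tower_var t m i).
Proof.
elim: m => [|m IHm].
  move=> P sP _ x; rewrite -[x]mulr1.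
  exact: (subalgZ sP x (subalg1 sP)).
apply: generates_sub (skewpoly_generates (tower_odd_generates IHm)).
move=> _ [[_ [i le_im ->] ->]|->].
  exists i; first by rewrite doubleS ltnS (leq_trans le_im).
  by rewrite /= ltnS le_im.
by exists m.*2.+1; rewrite ?doubleS //= ltnn.
Qed.

(** Indices start at 0, so the pairs with a nontrivial relation are (2l, 2l+1). The induction step
    distinguishes whether [j] is the last variable 2m+1, the variable 2m, or one of an earlier
    stage. *)
Lemma tower_var_rel m i j : (i < j < m.*2)%N ->
  tower_var t m j * tower_var t m i = tower_var t m i * tower_var t m j
    + (if odd j && (i.+1 == j) then t%:A else 0).
Proof.
elim: m => [|m IHm]; first by rewrite ltn0 andbF.
rewrite doubleS => /andP[lt_ij]; rewrite !ltnS leq_eqVlt => /predU1P[Dj|].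
  have -> : tower_var t m.+1 j = skewX by rewrite Dj /= ltnn.
  have -> : tower_var t m.+1 i = skewC _ (odd_var (tower_var t m) i).
    by rewrite /= -Dj lt_ij.
  (* The last variable acts by t d/dx_(2m), which is t on the variable 2m and 0 on the earlier
     ones. *)
  rewrite skewXC; congr (_ + _); rewrite Dj /= odd_double eqSS /odd_var.
  case: (ltngtP i m.*2) (lt_ij) => [lt_im _|gt_im|-> _]; last 1 first.
  - by rewrite scaled_partialX linearZ rmorph1.
  - by rewrite scaled_partialC rmorph0.
  - by rewrite Dj ltnS leqNgt gt_im.
rewrite ltnS => le_jm.
have oddE l : (l <= m.*2)%N ->
    tower_var t m.+1 l = skewC _ (odd_var (tower_var t m) l).
  by move=> le_lm /=; rewrite ltnS le_lm.
have lt_im : (i < m.*2)%N by apply: leq_trans le_jm.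
rewrite !oddE ?(ltnW lt_im) // -!rmorphM.
rewrite -(lrmorph_if (skewC (weyl_nu t m))).
rewrite -rmorphD; congr skewC; rewrite /odd_var lt_im.
move: le_jm; rewrite leq_eqVlt => /predU1P[->|lt_jm].
  (* The variable 2m is adjoined with zero derivation, and its index is even, so no t occurs on
     either side. *)
  by rewrite ltnn odd_double skewXC /= rmorph0.
rewrite lt_jm -!rmorphM IHm ?lt_ij // rmorphD; congr (_ + _).
exact: (lrmorph_if (skewC (zero_der (weyl_tower t m)))).
Qed.

(** Each stage applies [skewpoly_lift] twice, sending the two new variables to [v] at 2m and 2m+1.
    Indexing by [nat] lets the same [v] serve at every stage of the induction. *)
Lemma tower_lift m (B : algType S) (v : nat -> B) :
  (forall i j, (i < j < m.*2)%N ->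
     v j * v i = v i * v j + (if odd j && (i.+1 == j) then t%:A else 0)) ->
  exists g : {lrmorphism weyl_tower t m -> B},
    forall i, (i < m.*2)%N -> g (tower_var t m i) = v i.
Proof.
elim: m => [|m IHm] v_rel.
  (* The bottom of the tower is [S] itself, mapped by the structure morphism of [B]. *)
  pose f0 : S^o -> B := in_alg B.
  have fZ : scalable f0 by move=> s x; rewrite /f0 /= scalerA.
  pose fA := GRing.isZmodMorphism.Build _ _ f0 (raddfB (in_alg B)).
  pose fM := GRing.isMonoidMorphism.Build _ _ f0
    (rmorph1 (in_alg B), rmorphM (in_alg B)).
  pose fS := GRing.isScalable.Build _ _ _ _ f0 fZ.
  by pose f : {lrmorphism S^o -> B} := HB.pack f0 fA fM fS; exists f.
have [|g gv] := IHm.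
  move=> i j /andP[lt_ij lt_jm]; apply: v_rel; rewrite lt_ij doubleS ltnS.
  by rewrite ltnW // ltnW.
have rel1 a : v m.*2 * g a = g a * v m.*2 + g (zero_der _ a).
  apply: (tower_generates (skew_relation_subalgebra _ _ _)) a => _ [i lt_im ->].
  rewrite gv // rmorph0; rewrite v_rel ?odd_double ?addr0 //.
  by rewrite lt_im doubleS ltnS leqnSn.
have [g1 [g1C g1X]] := skewpoly_lift rel1.
have g1v i : (i <= m.*2)%N -> g1 (tower_odd_var t m i) = v i.
  rewrite leq_eqVlt /tower_odd_var /odd_var => /predU1P[->|lt_im].
    by rewrite ltnn g1X.
  by rewrite lt_im g1C gv.
have rel2 a : v m.*2.+1 * g1 a = g1 a * v m.*2.+1 + g1 (weyl_nu t m a).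
  apply: (tower_odd_generates (@tower_generates m)
    (skew_relation_subalgebra _ _ _)) a => _ [i le_im ->].
  rewrite g1v // v_rel; last by rewrite ltnS le_im doubleS ltnS leqnn.
  congr (_ + _); rewrite /= odd_double eqSS /tower_odd_var /odd_var.
  case: (ltngtP i m.*2) le_im => // _ _.
    by rewrite scaled_partialC rmorph0.
  by rewrite scaled_partialX linearZ rmorph1.
have [g2 [g2C g2X]] := skewpoly_lift rel2.
exists g2 => i; rewrite doubleS !ltnS leq_eqVlt => /predU1P[->|le_im].
  by rewrite /= ltnn g2X.
by rewrite /= le_im g2C g1v.
Qed.

End TowerTheory.

(* Not at the top: the notations of mpoly and monalg clash. *)
From mathcomp Require Import mpoly.

Lemma weyl_pairE n (i j : 'I_n.*2) :
  [exists l : 'I_n, (i == oddix l) && (j == evenix l)]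
  = odd j && (i.+1 == j :> nat).
Proof.
apply/existsP/andP => [[l /andP[/eqP-> /eqP->]]|[odd_j /eqP Dj]].
  by rewrite /= odd_double.
(* An odd [j] determines the pair: l is the half of j rounded down. *)
have Dl : j = (j./2.*2).+1 :> nat by rewrite -{1}[j : nat]odd_double_half odd_j.
have lt_jn : (j./2 < n)%N by rewrite -ltn_double ltnW // -Dl.
exists (Ordinal lt_jn); rewrite -!val_eqE /= -Dl eqxx andbT.
by rewrite -eqSS Dj -Dl.
Qed.

(** * The isomorphism with the tower, and its derivations *)

Section WeylTower.
Variables (k : fieldType) (n : nat).
Local Notation T := (weyl_tower ('X : {poly k}) n).

Lemma weyl_alg_tower : exists f : {lrmorphism weyl_alg k n -> T},
  bijective f /\ forall i : 'I_n.*2, f (weyl_gen k i) = tower_var 'X n i.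
Proof.
have [|f fX] := @weyl_alg_lift_lr k n T (fun i => tower_var 'X n i).
  by move=> i j lt_ij; rewrite weyl_pairE tower_var_rel // lt_ij ltn_ord.
(* The generators are extended by 0 beyond the index range, since [tower_lift] takes a family
   indexed by [nat]. *)
pose v (i : nat) : weyl_alg k n :=
  if insub i is Some j then weyl_gen k j else 0.
have vE (i : 'I_n.*2) : v i = weyl_gen k i by rewrite /v valK.
have [|g gX] := @tower_lift _ 'X n (weyl_alg k n) v.
  move=> i j /andP[lt_ij lt_j]; have lt_i := ltn_trans lt_ij lt_j.
  rewrite (vE (Ordinal lt_i)) (vE (Ordinal lt_j)).
  by rewrite weyl_gen_rel // weyl_pairE.
exists f; split=> //; exists g.
  apply: (@lrmorphism_eq _ _ _ _ (g \o f) idfun (@weyl_alg_generates k n)).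
  by move=> _ [i ->]; rewrite /= fX gX ?vE.
apply: (@lrmorphism_eq _ _ _ _ (f \o g) idfun (@tower_generates _ 'X n)).
by move=> _ [i lt_i ->]; rewrite /= gX // (vE (Ordinal lt_i)) fX.
Qed.

Lemma weyl_nu_unique m (d : derivation (weyl_tower_odd ('X : {poly k}) m)) :
  (forall i, (i <= m.*2)%N ->
     d (tower_odd_var 'X m i) = if i == m.*2 then 'X%:A else 0)
  <-> d =1 weyl_nu 'X m.
Proof.
have nuE i : (i <= m.*2)%N ->
    weyl_nu 'X m (tower_odd_var 'X m i)
    = if i == m.*2 then ('X : {poly k})%:A else 0.
  rewrite leq_eqVlt /= /tower_odd_var /odd_var => /predU1P[->|lt_im].
    by rewrite ltnn eqxx scaled_partialX.
  by rewrite lt_im ltn_eqF // scaled_partialC.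
split=> [dE|dE i le_im]; last by rewrite dE nuE.
apply: (tower_odd_generates (@tower_generates _ _ m)
  (eq_derivation_subalgebra _ _)).
by move=> _ [i le_im ->]; rewrite dE // nuE.
Qed.
End WeylTower.

(** Scalars act coefficientwise on skew polynomials, so torsion-freeness passes from R to R[z; nu].
    It starts from the domain [S] and is used twice per stage. *)
Lemma weyl_tower_torsion_free (S : idomainType) (t : S) n (s : S)
    (x : weyl_tower t n) : s *: x = 0 -> s = 0 \/ x = 0.
Proof.
have skew0 (R : algType S) (nu : derivation R) :
    (forall a : R, s *: a = 0 -> s = 0 \/ a = 0) ->
    forall p : skewpoly nu, s *: p = 0 -> s = 0 \/ p = 0.
  move=> R0 p sp0; have [-> | /eqP s0] := eqVneq s 0; [by left | right].
  apply/polyP=> i; rewrite coef0.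
  have : (s%:A *: (p : {poly R}))`_i = 0 by rewrite [_ *: _]sp0 coef0.
  by rewrite coefZ mulr_algl => /R0[].
elim: n x => [|n IHn] x.
  by move/eqP; rewrite mulf_eq0 => /orP[]/eqP; [left|right].
exact/skew0/skew0.
Qed.

(** * Regularity of t *)

Section Regularity.
Variables (k : fieldType) (n : nat).
Local Notation A := (weyl_alg k n).

(** At t = 0 all the defining relations become commutativity, which holds in the polynomial ring. *)
Lemma weyl_specialize : exists f : {rmorphism A -> {mpoly k[n.*2]}},
  (forall i, f (weyl_gen k i) = 'X_i)
  /\ forall s x, f (s *: x) = s.[0]%:MP * f x.
Proof.
pose c : {rmorphism {poly k} -> {mpoly k[n.*2]}} :=
  @mpolyC n.*2 k \o horner_eval (0 : k).
have c_central s b : GRing.comm (c s) b by apply: mulrC.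
have [|f [fX fZ]] := weyl_alg_lift (v := fun i => 'X_i) c_central.
  move=> i j _; rewrite mulrC; case: ifP => _; rewrite ?addr0 //.
  by rewrite /c /= horner_evalE hornerX mpolyC0 addr0.
by exists f.
Qed.

(* The bracket {x_i, x_j}, in A/tA as well as in the Poisson Weyl algebra. *)
Definition weyl_form (i j : 'I_n.*2) : k :=
  (odd i && (j.+1 == i :> nat))%:R - (odd j && (i.+1 == j :> nat))%:R.

Lemma weyl_gen_comm i j :
  weyl_gen k i * weyl_gen k j - weyl_gen k j * weyl_gen k i
  = 'X *: ((weyl_form i j)%:P *: 1) :> A.
Proof.
wlog lt_ij : i j / (i < j)%N.
  have swap (x y z : A) : x - y = z -> y - x = - z by move=> <-; rewrite opprB.
  move=> IH; case: (ltngtP i j) => [/IH//|/IH/swap ->|/val_inj <-].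
    by rewrite -scalerN -scaleNr -polyCN /weyl_form opprB.
  by rewrite /weyl_form !subrr polyC0 scale0r scaler0.
rewrite (weyl_gen_rel k lt_ij) weyl_pairE opprD addNKr /weyl_form.
(* For i < j only the second term of [weyl_form] can be nonzero; it enters with a minus sign because
   the defining relation adds t to the product with [j] on the left. *)
have -> : (j.+1 == i :> nat) = false by rewrite gtn_eqF // ltnW.
rewrite andbF sub0r; case: (_ && _); rewrite polyCN scaleNr scalerN.
  by rewrite polyC1 scale1r.
by rewrite polyC0 scale0r scaler0.
Qed.

Lemma weyl_alg_comm (a b : A) : exists c : A, a * b - b * a = 'X *: c.
Proof.
apply: (generates_comm (@weyl_alg_generates k n)) => _ _ [i ->] [j ->].
by exists ((weyl_form i j)%:P *: 1); apply: weyl_gen_comm.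
Qed.

Lemma weyl_t_regular : regular_element (weyl_t k n).
Proof.
have tM (a : A) : weyl_t k n * (a : res_scalars A) = 'X *: a.
  exact: (mulr_algl ('X : {poly k}) a).
have Mt (a : A) : (a : res_scalars A) * weyl_t k n = 'X *: a.
  exact: (mulr_algr ('X : {poly k}) a).
have X0 (a : A) : 'X *: a = 0 -> a = 0.
  (* Cancellation of t is transported from the tower along the isomorphism. *)
  move=> Xa0; have [f [/bij_inj f_inj _]] := weyl_alg_tower k n.
  apply: f_inj; rewrite rmorph0.
  have /weyl_tower_torsion_free[] // : 'X *: f a = 0.
    by rewrite -linearZ Xa0 rmorph0.
  by move/eqP; rewrite polyX_eq0.
split.
- move=> t0; have := X0 1; rewrite -tM t0 mul0r => /(_ erefl) /eqP.
  by rewrite oner_eq0.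
- case=> b [_]; rewrite tM => Xb.
  (* The specialization kills t, so an inverse of t would give 0 = 1 in the polynomial ring. *)
  have [f [_ fZ]] := weyl_specialize.
  have := congr1 f Xb; rewrite fZ hornerX mpolyC0 mul0r rmorph1 => /eqP.
  by rewrite eq_sym oner_eq0.
- by move=> a; split=> a0; apply: X0; [rewrite -tM|rewrite -Mt].
- by move=> a; rewrite [LHS]tM [RHS]Mt.
move=> a b; have [c abc] := weyl_alg_comm a b.
by exists c; rewrite [RHS]tM.
Qed.
End Regularity.

(** * Poisson brackets and the semiclassical limit *)

Section PoissonTheory.
Variables (k : fieldType).

Lemma pbrN (R : poissonAlgType k) (x y : R) : pbr x y = - pbr y x.
Proof.
have D u v w : pbr (u + v) w = pbr u w + pbr v w :> R.
  by have := pbr_linearl w 1 u v; rewrite !scale1r.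
have D' u v w : pbr w (u + v) = pbr w u + pbr w v :> R.
  by have := pbr_linearr w 1 u v; rewrite !scale1r.
have /eqP := pbrxx (x + y).
by rewrite D !D' !pbrxx add0r addr0 addr_eq0 => /eqP.
Qed.

Lemma pbr1 (R : poissonAlgType k) (x : R) : pbr 1 x = 0.
Proof.
have := pbr_leibniz 1 1 x; rewrite !mulr1 mul1r => /eqP.
by rewrite -subr_eq0 opprD addrA subrr sub0r oppr_eq0 => /eqP.
Qed.

(** Compatibility with the bracket against a fixed element is closed under products by the Leibniz
    rule; antisymmetry handles the other argument. *)
Lemma generates_pbr_morph (R R' : poissonAlgType k) (G : R -> Prop)
    (f : {lrmorphism R -> R'}) : generates G ->
  (forall x y, G x -> G y -> f (pbr x y) = pbr (f x) (f y)) ->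
  forall x y, f (pbr x y) = pbr (f x) (f y).
Proof.
move=> genG GP.
have sub z : subalgebra (fun x => f (pbr x z) = pbr (f x) (f z)).
  split=> [|s x y fx fy|x y fx fy].
  - by rewrite rmorph1 !pbr1 rmorph0.
  - by rewrite linearP !pbr_linearl linearP /= fx fy.
  - by rewrite rmorphM !pbr_leibniz rmorphD !rmorphM /= fx fy.
have swap x y : f (pbr x y) = pbr (f x) (f y) -> f (pbr y x) = pbr (f y) (f x).
  by rewrite pbrN rmorphN [pbr (f x) _]pbrN => /oppr_inj.
move=> x y; apply: (genG _ (sub y)) x => x Gx.
by apply: swap; apply: (genG _ (sub x)) y => y Gy; apply: GP.
Qed.
End PoissonTheory.

Section SemiclassicalWeyl.
Variables (k : fieldType) (n : nat).
Local Notation A := (weyl_alg k n).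
Local Notation B := (poisson_weyl k n).

(** At most one l contributes, because [oddix] is injective. *)
Lemma sum_weyl_pair (i j : 'I_n.*2) :
  \sum_(l < n) ((i == oddix l) && (j == evenix l))%:R
  = (odd j && (i.+1 == j :> nat))%:R :> k.
Proof.
rewrite -weyl_pairE; case: existsP => [[l /andP[/eqP-> /eqP->]]|no_l].
  rewrite (bigD1 l) //= !eqxx big1 ?addr0 // => l' /negPf ll'.
  by rewrite -!val_eqE /= eqSS andbb (inj_eq double_inj) val_eqE eq_sym ll'.
by rewrite big1 // => l _; case ij: (_ && _) => //; case: no_l; exists l.
Qed.

Lemma mderivXU (i j : 'I_n.*2) :
  ('X_i : {mpoly k[n.*2]})^`M(j) = ((i == j)%:R)%:MP.
Proof.
rewrite mderivX mnm1E; case: eqVneq => [->|_]; last by rewrite scale0r mpolyC0.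
rewrite scale1r mpolyC1 -mpolyX0; congr 'X_[_].
by apply/mnmP=> l; rewrite mnmBE mnm0E subnn.
Qed.

Lemma weyl_bracket_gen (i j : 'I_n.*2) :
  weyl_bracket 'X_i 'X_j = (weyl_form k i j)%:MP.
Proof.
rewrite /weyl_form -!sum_weyl_pair -sumrN -big_split /= raddf_sum.
rewrite /weyl_bracket; apply: eq_bigr => l _ /=.
rewrite !mderivXU -!mpolyCM -mpolyCN -mpolyCD -!natrM !mulnb.
by rewrite [in RHS]addrC.
Qed.

Lemma poisson_weyl_generates : generates (fun p : B => exists i, p = 'X_i).
Proof.
move=> P sP PX; apply: mpoly_gen_ind.
- exact: subalg1 sP.
- exact: subalgP sP.
- exact: subalgM sP.
- by move=> i; apply: PX; exists i.
Qed.

Variable t_reg : regular_element (weyl_t k n).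
Local Notation Q := (semiclassical_limit t_reg).
Local Notation pi := (quot_pi (reg_ideal t_reg) : A -> Q).

(** Modulo t a polynomial acts through its constant term, as s - s(0) is divisible by t. *)
Lemma weyl_piZ (s : {poly k}) (x : A) : pi (s *: x) = s.[0] *: pi x.
Proof.
have /factor_theorem[q Dq] : root (s - s.[0]%:P) 0.
  by rewrite rootE hornerD hornerN hornerC subrr.
have -> : s.[0] *: pi x = pi (s.[0]%:P *: x).
  (* On [res_scalars], the action of [k] is by definition that of constant polynomials. *)
  by rewrite -[RHS]/(pi (s.[0] *: (x : res_scalars A))) linearZ.
apply/quot_pi_eq; exists (q *: x).
rewrite -[LHS]scalerBl Dq subr0 mulrC -scalerA.
exact/esym/(mulr_algl ('X : {poly k})).
Qed.

Lemma weyl_piP (s : {poly k}) (x y : A) :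
  pi (s *: x + y) = s.[0] *: pi x + pi y.
Proof. by rewrite -weyl_piZ [LHS]rmorphD. Qed.

(** Substitution into the quotient is a morphism because A/tA is commutative. *)
Lemma poisson_weyl_lift : exists g : {lrmorphism B -> Q},
  forall i, g 'X_i = pi (weyl_gen k i).
Proof.
pose h i : Q := pi (weyl_gen k i).
pose g0 : B -> Q := mmap (in_alg Q) h.
have gM : monoid_morphism g0 by split; [exact: rmorph1|exact: rmorphM].
have gZ : scalable g0 by move=> c p; rewrite /g0 mmapZ /= mulr_algl.
pose mA := GRing.isZmodMorphism.Build _ _ g0 (raddfB (mmap (in_alg Q) h)).
pose mM := GRing.isMonoidMorphism.Build _ _ g0 gM.
pose mZ := GRing.isScalable.Build _ _ _ _ g0 gZ.
pose g : {lrmorphism B -> Q} := HB.pack g0 mA mM mZ.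
by exists g => i; rewrite /g /= /g0 mmapX mmap1U.
Qed.

Lemma semiclassical_weyl : poisson_isomorphic Q B.
Proof.
have [g gX] := poisson_weyl_lift.
have [f [fX fZ]] := weyl_specialize k n.
have f_t x : reg_ideal t_reg x -> f x = 0.
  move=> [a ->]; rewrite [LHS](rmorphM f) [X in X * _](fZ 'X 1).
  by rewrite hornerX mpolyC0 !mul0r.
have [h hE] := quot_alg_lift f_t.
have hZ : scalable h.
  move=> c x; have [a ->] := quot_pi_surj x.
  by rewrite -linearZ !hE [LHS]fZ hornerC mul_mpolyC.
pose hS := GRing.isScalable.Build _ _ _ _ h hZ.
pose psi : {lrmorphism Q -> B} := HB.pack (h : Q -> B) h hS.
(* The maps [f] and [pi] are semilinear over evaluation at t = 0, so [lrmorphism_eq] does not apply;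
   the subalgebra of agreement is checked directly. *)
have gf (a : A) : g (f a) = pi a.
  apply: (@weyl_alg_generates k n (fun a => g (f a) = pi a)) a.
    split=> [|s x y fx fy|x y fx fy]; first by rewrite !rmorph1.
    - by rewrite rmorphD fZ mul_mpolyC [LHS](linearP g) /= fx fy weyl_piP.
    - have -> : g (f (x * y)) = g (f x) * g (f y).
        by rewrite (rmorphM f); exact: (rmorphM g).
      by rewrite fx fy [RHS]rmorphM.
  by move=> _ [i ->]; rewrite fX gX.
have psiK : cancel psi g.
  by move=> x; have [a ->] := quot_pi_surj x; rewrite [psi _]hE gf.
have gK : cancel g psi.
  apply: (lrmorphism_eq (f := psi \o g) (g := idfun) poisson_weyl_generates).
  by move=> _ [i ->] /=; rewrite gX [LHS]hE fX.
(* Brackets are compared along [g], whose source is generated by the variables; there they are the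
   constants [weyl_form]. *)
have g_pbr : forall p q, g (pbr p q) = pbr (g p) (g q).
  apply: (generates_pbr_morph poisson_weyl_generates) => _ _ [i ->] [j ->].
  have -> : pbr ('X_i : B) ('X_j : B) = weyl_form k i j *: 1.
    by rewrite -[LHS]/(weyl_bracket _ _) weyl_bracket_gen -mul_mpolyC mulr1.
  rewrite !gX [RHS](semiclassical_bracketE t_reg).
  have -> : hcomm t_reg (weyl_gen k i) (weyl_gen k j)
      = ((weyl_form k i j)%:P *: 1 : A).
    (* Division by t is unique, so it suffices to compare after multiplying by t, where
       [weyl_gen_comm] applies. *)
    apply: (reg_lreg t_reg); rewrite -hcommE [LHS]weyl_gen_comm.
    exact/esym/(mulr_algl ('X : {poly k})).
  by rewrite [RHS]weyl_piZ hornerC linearZ !rmorph1.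
exists psi; split; first by exists g.
(* Compatibility with brackets passes from [g] to its inverse [psi]. *)
by move=> a b; rewrite -{1}[a]psiK -{1}[b]psiK -g_pbr gK.
Qed.
End SemiclassicalWeyl.

Theorem proposition3p2 (k : closedFieldType) (n : nat) :
  [pchar k] =i pred0 -> (1 <= n)%N ->
  [/\ exists t_regular : regular_element (weyl_t k n),
        poisson_isomorphic (semiclassical_limit t_regular) (poisson_weyl k n),
      exists f : {lrmorphism weyl_alg k n -> weyl_tower ('X : {poly k}) n},
        bijective f /\
        forall i : 'I_n.*2, f (weyl_gen k i) = tower_var 'X n i
    & forall (m : 'I_n) (d : derivation (weyl_tower_odd ('X : {poly k}) m)),
        (forall i : nat, (i <= m.*2)%N ->
           d (tower_odd_var 'X m i) = if i == m.*2 then 'X%:A else 0)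
        <-> d =1 weyl_nu 'X m].
Proof.
move=> _ _; split.
- by exists (weyl_t_regular k n); apply: semiclassical_weyl.
- exact: weyl_alg_tower.
- by move=> m d; apply: weyl_nu_unique.
Qed.
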